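(* Let $A$ be a finite nonempty set of positive real numbers and let $k\geq 1$ be an integer. Then $$|4^{k-1}A^{(k)}|\geq |A|^k.$$
   Context: For a finite set $X$ of numbers and an integer $m\ge1$, $mX:=\{x_1+\cdots+x_m: x_1,\dots,x_m\in X\}$ is the $m$-fold sum set and $X^{(m)}:=\{x_1\cdots x_m: x_1,\dots,x_m\in X\}$ the $m$-fold product set. Thus $4^{k-1}A^{(k)}$ is the $4^{k-1}$-fold sum set of the $k$-fold product set of $A$. *)

(* Defs.v *)
(* classical real numbers R. Finite sets of reals are
   represented by duplicate-free lists. *)
From Stdlib Require Import Reals List.
Import ListNotations.
Open Scope R_scope.

Fixpoint in_prod_set (X : list R) (m : nat) (x : R) : Prop :=
  match m with
  | O => x = 1
  | S m' => exists a y, In a X /\ in_prod_set X m' y /\ x = a * y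
  end.

Fixpoint in_sum_set (P : R -> Prop) (m : nat) (x : R) : Prop :=
  match m with
  | O => x = 0
  | S m' => exists a y, P a /\ in_sum_set P m' y /\ x = a + y
  end.

(* Main.v *)
(** Write A' = A + A and X for the set obtained at stage k - 1; stage k contains
    T = A'X + A'X.  In A x A, adding to each point a point on the line through
    the origin with the next larger slope gives a new slope strictly between the
    two; this produces at least |A|^2 + 1 distinct slopes of points of A' x A'
    when |A| >= 2.  If p and q are points of A' x A' with consecutive slopes
    among these, the |X|^2 points x p + y q lie in T x T, are distinct by linear
    independence, and have slopes strictly between those of p and q.  Hence
    |T|^2 >= |A|^2 |X|^2. *)
Require Import Defs.
From Stdlib Require Import Reals List Lra Lia.
Import ListNotations.
Open Scope R_scope.

(** * Duplicate-free lists, maxima and representatives *)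

(** Counts objects that are specified only by a relation: one witness is picked per source, and
    since equal [f]-values force equal sources, each new value is fresh. [f] will be [slope] when
    slopes are counted and the identity when points are counted. *)
Lemma choose_NoDup_map {X Y Z : Type} (f : Y -> Z) (P : X -> Y -> Prop) (l : list X) :
  NoDup l ->
  (forall x, In x l -> exists y, P x y) ->
  (forall x x' y y', In x l -> In x' l -> P x y -> P x' y' -> f y = f y' -> x = x') ->
  exists l' : list Y, NoDup (map f l') /\ length l' = length l /\
    (forall y, In y l' -> exists x, In x l /\ P x y).
Proof.
induction l as [|x l IH]; intros Hnd Hex Hinj.
- exists []; simpl; split; [constructor | split; [reflexivity | tauto]].
- inversion Hnd as [|? ? Hx Hl]; subst.
  destruct IH as (l' & Hl' & Hlen & HP); auto.
  + intros; apply Hex; now right.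
  + intros x1 x2 y1 y2 H1 H2; apply Hinj; now right.
  + destruct (Hex x (or_introl eq_refl)) as [y Hy].
    exists (y :: l'); simpl; split; [|split].
    * constructor; auto.
      intros Hin; apply in_map_iff in Hin as (y' & Hf & Hy').
      destruct (HP y' Hy') as (x' & Hx' & HP').
      apply Hx; replace x with x'; auto.
      apply (Hinj x' x y' y); simpl; auto.
    * now rewrite Hlen.
    * intros z [<-|Hz]; [exists x; auto|].
      destruct (HP z Hz) as (x' & Hx' & HP'); exists x'; auto.
Qed.

Lemma NoDup_map_inj_in {Y Z : Type} (f : Y -> Z) (l : list Y) (y y' : Y) :
  NoDup (map f l) -> In y l -> In y' l -> f y = f y' -> y = y'.
Proof.
induction l as [|z l IH]; simpl; [tauto|].
intros H; inversion H as [|? ? Hz Hl]; subst.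
intros [<-|Hy] [<-|Hy'] E; auto.
- destruct Hz; rewrite E; now apply in_map.
- destruct Hz; rewrite <- E; now apply in_map.
Qed.

Lemma NoDup_list_prod {Y Z : Type} (l : list Y) (l' : list Z) :
  NoDup l -> NoDup l' -> NoDup (list_prod l l').
Proof.
intros Hl Hl'; induction Hl as [|y l Hy Hl IH]; simpl; [constructor|].
apply NoDup_app; auto.
- apply NoDup_map_NoDup_ForallPairs; auto.
  intros z z' _ _ E; now injection E.
- intros p Hp Hin; apply in_map_iff in Hp as (z & <- & _).
  now apply in_prod_iff in Hin.
Qed.

Lemma exists_max {Y : Type} (f : Y -> R) (l : list Y) :
  l <> [] -> exists m, In m l /\ forall y, In y l -> f y <= f m.
Proof.
induction l as [|z l IH]; [easy|]; intros _.
destruct l as [|z' l].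
- exists z; simpl; split; auto; intros y [<-|[]]; lra.
- destruct IH as (m & Hm & Hmax); [easy|].
  destruct (Rle_dec (f z) (f m)) as [H|H].
  + exists m; split; [now right|]; intros y [<-|Hy]; auto.
  + exists z; split; [now left|]; intros y [<-|Hy]; [lra|].
    specialize (Hmax y Hy); lra.
Qed.

(** Several points of A x A may share a slope; keeping one point per slope makes the point of next
    larger slope unique. *)
Lemma exists_representatives {Y : Type} (f : Y -> R) (l : list Y) :
  exists l', NoDup (map f l') /\ incl l' l /\
    (forall y, In y l -> exists y', In y' l' /\ f y' = f y).
Proof.
induction l as [|z l (l' & Hnd & Hincl & Hrep)].
- exists []; simpl; split; [constructor | split; [easy | tauto]].
- destruct (in_dec Req_dec_T (f z) (map f l')) as [H|H].
  + exists l'; split; [easy | split; [now apply incl_tl|]].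
    intros y [<-|Hy]; auto.
    apply in_map_iff in H as (y' & E & Hy'); exists y'; auto.
  + exists (z :: l'); split; [now constructor | split].
    * intros y [<-|Hy]; [now left | right; auto].
    * intros y [<-|Hy]; [exists z; simpl; auto|].
      destruct (Hrep y Hy) as (y' & Hy' & E); exists y'; simpl; auto.
Qed.

(** * Consecutive values of a function on a list *)

(** The threshold is a number [r] and not an entry of [l], so that it can be the slope of a point
    that is not itself a chosen representative. *)
Definition is_next {Y : Type} (f : Y -> R) (l : list Y) (r : R) (q : Y) : Prop :=
  In q l /\ r < f q /\ forall q', In q' l -> r < f q' -> f q <= f q'.

Lemma exists_next {Y : Type} (f : Y -> R) (l : list Y) (r : R) (m : Y) :
  In m l -> r < f m -> exists q, is_next f l r q.
Proof.
intros Hm Hr.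
set (above := fun y => if Rlt_dec r (f y) then true else false).
assert (Habove : forall y, In y (filter above l) <-> In y l /\ r < f y).
{ intros y; rewrite filter_In; unfold above.
  destruct (Rlt_dec r (f y)); split; intros []; split; auto; easy. }
destruct (exists_max (fun y => - f y) (filter above l)) as (q & Hq & Hmin).
- intros E; assert (H : In m (filter above l)) by now apply Habove.
  now rewrite E in H.
- apply Habove in Hq as [Hq Hrq]; exists q; split; [easy | split; [easy|]].
  intros q' Hq' Hr'; specialize (Hmin q' (proj2 (Habove q') (conj Hq' Hr'))); lra.
Qed.

Lemma is_next_unique {Y : Type} (f : Y -> R) (l : list Y) (r : R) (q q' : Y) :
  NoDup (map f l) -> is_next f l r q -> is_next f l r q' -> q = q'.
Proof.
intros Hnd (Hq & Hrq & Hmin) (Hq' & Hrq' & Hmin').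
apply (NoDup_map_inj_in f l); auto.
apply Rle_antisym; auto.
Qed.

(** Open intervals between consecutive values are disjoint: if [f p < f p'], then [f q <= f p'],
    which puts [z] on both sides of [f p']. *)
Lemma is_next_gap {Y : Type} (f : Y -> R) (l : list Y) (p p' q q' : Y) (z : R) :
  In p l -> In p' l -> is_next f l (f p) q -> is_next f l (f p') q' ->
  f p < z < f q -> f p' < z < f q' -> f p = f p'.
Proof.
intros Hp Hp' (_ & _ & Hmin) (_ & _ & Hmin') Hz Hz'.
destruct (Rtotal_order (f p) (f p')) as [H|[H|H]]; auto.
- specialize (Hmin p' Hp' H); lra.
- specialize (Hmin' p Hp H); lra.
Qed.

(** * Slopes of positive combinations of two points *)

Definition slope (p : R * R) : R := snd p / fst p.

Definition comb (x : R) (p : R * R) (y : R) (q : R * R) : R * R :=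
  (x * fst p + y * fst q, x * snd p + y * snd q).

Lemma snd_slope (p : R * R) : 0 < fst p -> snd p = slope p * fst p.
Proof. intros H; unfold slope; field; lra. Qed.

(** The slope of the combination is the mean of the two slopes with positive weights [x * fst p] and
    [y * fst q]. *)
Lemma slope_comb_between (x y : R) (p q : R * R) :
  0 < x -> 0 < y -> 0 < fst p -> 0 < fst q -> slope p < slope q ->
  slope p < slope (comb x p y q) < slope q.
Proof.
intros Hx Hy Hp Hq H.
assert (Hxp := Rmult_lt_0_compat _ _ Hx Hp).
assert (Hyq := Rmult_lt_0_compat _ _ Hy Hq).
assert (E : slope (comb x p y q) =
  (slope p * (x * fst p) + slope q * (y * fst q)) / (x * fst p + y * fst q)).
{ unfold slope, comb; simpl; field; lra. }
rewrite E; split.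
- apply Rmult_lt_reg_r with (x * fst p + y * fst q); [lra|].
  unfold Rdiv; rewrite Rmult_assoc, Rinv_l by lra; nra.
- apply Rmult_lt_reg_r with (x * fst p + y * fst q); [lra|].
  unfold Rdiv; rewrite Rmult_assoc, Rinv_l by lra; nra.
Qed.

(** Moving [p] along its line through the origin changes its weight in the mean of the two slopes.
    With slopes [s], [t] and abscissas [a], [a'], [c], cross-multiplication leaves
    [(s - t) * (c * (a - a')) = 0]. *)
Lemma slope_add_inj (p p' q : R * R) :
  0 < fst p -> 0 < fst p' -> 0 < fst q -> slope p = slope p' -> slope p <> slope q ->
  slope (comb 1 p 1 q) = slope (comb 1 p' 1 q) -> p = p'.
Proof.
intros Hp Hp' Hq E Hne H.
assert (Es := snd_slope p Hp). assert (Es' := snd_slope p' Hp').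
assert (Eq := snd_slope q Hq).
rewrite <- E in Es'; clear E.
revert Hne Es Es' Eq; generalize (slope p) (slope q); intros s t Hne Es Es' Eq.
destruct p as [a b], p' as [a' b'], q as [c d]; simpl in *.
assert (K : (s * a + t * c) * (a' + c) = (s * a' + t * c) * (a + c)).
{ unfold slope, comb in H; simpl in H; rewrite Es, Es', Eq in H.
  transitivity ((1 * (s * a) + 1 * (t * c)) / (1 * a + 1 * c) * (a + c) * (a' + c)).
  - field; lra.
  - rewrite H; field; lra. }
assert (K' : (s - t) * (c * (a - a')) = 0) by lra.
apply Rmult_integral in K' as [K'|K']; [lra|].
apply Rmult_integral in K' as [K'|K']; [lra|].
assert (a = a') by lra; subst; reflexivity.
Qed.

Lemma comb_inj (x y x' y' : R) (p q : R * R) :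
  0 < fst p -> 0 < fst q -> slope p <> slope q ->
  comb x p y q = comb x' p y' q -> x = x' /\ y = y'.
Proof.
intros Hp Hq Hne H.
assert (Es := snd_slope p Hp). assert (Et := snd_slope q Hq).
injection H as H1 H2; rewrite Es, Et in H2.
(* Subtracting the second coordinate from [slope p] times the first eliminates the coefficient of
   [p]. *)
assert (K : (slope p - slope q) * (fst q * (y - y')) = 0).
{ replace ((slope p - slope q) * (fst q * (y - y'))) with
   (slope p * ((x * fst p + y * fst q) - (x' * fst p + y' * fst q))
    - ((x * (slope p * fst p) + y * (slope q * fst q))
       - (x' * (slope p * fst p) + y' * (slope q * fst q)))) by ring.
  rewrite H1, H2; ring. }
apply Rmult_integral in K as [K|K]; [lra|].
apply Rmult_integral in K as [K|K]; [lra|].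
assert (Ey : y = y') by lra; split; [|easy].
subst y'; apply Rmult_eq_reg_r with (fst p); lra.
Qed.

(** * Many slopes, and many points between consecutive slopes *)

(** Each of the |A|^2 - 1 points of A x A other than the steepest one yields a new slope strictly
    inside a gap between slopes of A x A. Two slopes of A x A itself, realized by doubled points,
    complete the count. *)
Lemma sumset_many_slopes (A : list R) :
  NoDup A -> (2 <= length A)%nat -> (forall a, In a A -> 0 < a) ->
  exists L : list (R * R), NoDup (map slope L) /\
    length L = S (length A * length A) /\
    (forall p, In p L -> exists a b c d,
       In a A /\ In b A /\ In c A /\ In d A /\ p = (a + b, c + d)).
Proof.
intros Hnd Hlen Hpos.
assert (Hne : A <> []) by (intros ->; simpl in Hlen; lia).
destruct (exists_max (fun a => a) A Hne) as (M & HM & Hmax).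
destruct (exists_max (fun a => - a) A Hne) as (m & Hm & Hmin).
assert (HmM : m < M).
{ destruct A as [|a [|b A]]; simpl in Hlen; try lia.
  assert (a <> b).
  { intros ->; inversion Hnd as [|? ? H _]; apply H; now left. }
  assert (Ha := Hmax a); assert (Hb := Hmax b).
  assert (Ha' := Hmin a); assert (Hb' := Hmin b); simpl in *.
  specialize (Ha (or_introl eq_refl)); specialize (Ha' (or_introl eq_refl)).
  specialize (Hb (or_intror (or_introl eq_refl))).
  specialize (Hb' (or_intror (or_introl eq_refl))); lra. }
assert (Hm0 := Hpos m Hm).
set (P := list_prod A A).
assert (HP : forall p, In p P -> In (fst p) A /\ In (snd p) A).
{ intros [u v] H; now apply in_prod_iff in H. }
assert (HP0 : forall p, In p P -> 0 < fst p) by (intros p H; apply Hpos, HP, H).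
(* Least abscissa and greatest ordinate: the only point of maximal slope, hence the only one with no
   next slope. *)
set (top := (m, M)).
assert (Htop : In top P) by now apply in_prod.
assert (Hlt : forall p, In p P -> p <> top -> slope p < slope top).
{ intros [u v] Hp Hpt; destruct (HP _ Hp) as [Hu Hv]; simpl in Hu, Hv.
  specialize (Hmin u Hu); specialize (Hmax v Hv); simpl in *.
  assert (Hu0 := Hpos u Hu); assert (Hv0 := Hpos v Hv).
  assert (Hcr : v * m < M * u).
  { destruct (Req_dec u m) as [->|Hum].
    - assert (v <> M) by (intros ->; now apply Hpt); nra.
    - nra. }
  unfold slope; simpl.
  apply Rmult_lt_reg_r with (u * m); [nra|].
  replace (v / u * (u * m)) with (v * m) by (field; lra).
  replace (M / m * (u * m)) with (M * u) by (field; lra); easy. }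
destruct (exists_representatives slope P) as (L & HL & HLP & Hrep).
destruct (in_split top P Htop) as (P1 & P2 & EP).
assert (HPnd : NoDup P) by now apply NoDup_list_prod.
assert (Hrem : forall p, In p (P1 ++ P2) -> In p P /\ p <> top).
{ intros p Hp; split.
  - rewrite EP; apply in_app_iff in Hp as []; apply in_app_iff; simpl; auto.
  - intros ->; rewrite EP in HPnd; now apply NoDup_remove_2 in HPnd. }
(* Here [p] runs over all points except [top], so points on one line count separately; only the
   added point [q] is restricted to the representatives [L]. *)
destruct (choose_NoDup_map slope
  (fun p z => exists q, is_next slope L (slope p) q /\ z = comb 1 p 1 q) (P1 ++ P2))
  as (L' & HL' & Hlen' & Hfrom).
- rewrite EP in HPnd; now apply NoDup_remove_1 in HPnd.
- intros p Hp; destruct (Hrem p Hp) as [HpP Hpt].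
  destruct (Hrep top Htop) as (t & Ht & Et).
  destruct (exists_next slope L (slope p) t Ht) as [q Hq].
  + rewrite Et; now apply Hlt.
  + now exists (comb 1 p 1 q), q.
- intros p p' z z' Hp Hp' (q & Hq & ->) (q' & Hq' & ->) E.
  destruct (Hrem p Hp) as [HpP _], (Hrem p' Hp') as [HpP' _].
  destruct (Hrep p HpP) as (r & Hr & Er), (Hrep p' HpP') as (r' & Hr' & Er').
  assert (Hq0 := HP0 q (HLP q (proj1 Hq))).
  assert (Hq0' := HP0 q' (HLP q' (proj1 Hq'))).
  assert (B := slope_comb_between 1 1 p q Rlt_0_1 Rlt_0_1 (HP0 p HpP) Hq0
    (proj1 (proj2 Hq))).
  assert (B' := slope_comb_between 1 1 p' q' Rlt_0_1 Rlt_0_1 (HP0 p' HpP') Hq0'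
    (proj1 (proj2 Hq'))).
  rewrite <- E in B'.
  (* The slope of the sum determines first the gap, hence [slope p], then the representative [q],
     and finally the position of [p] on its line. *)
  assert (Es : slope p = slope p').
  { rewrite <- Er, <- Er' in *; eapply is_next_gap; eauto. }
  rewrite <- Es in Hq'.
  assert (q = q') by (eapply is_next_unique; eauto); subst q'.
  apply (slope_add_inj p p' q); auto; lra.
(* A new slope lies strictly between consecutive slopes of [P], so it is not a slope of [P]. *)
- assert (Hgap : forall z, In z L' -> forall p, In p P -> slope z <> slope p).
  { intros z Hz p Hp E; destruct (Hfrom z Hz) as (p0 & Hp0 & q & Hq & ->).
    destruct (Hrem p0 Hp0) as [HpP _].
    assert (Hq0 := HP0 q (HLP q (proj1 Hq))).
    assert (B := slope_comb_between 1 1 p0 q Rlt_0_1 Rlt_0_1 (HP0 p0 HpP) Hq0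
      (proj1 (proj2 Hq))).
    destruct (Hrep p Hp) as (r & Hr & Er).
    assert (H := proj2 (proj2 Hq) r Hr); lra. }
  assert (Hdiag : In (m, m) P) by now apply in_prod.
  assert (Edbl : forall u v, 0 < u -> slope (u + u, v + v) = slope (u, v)).
  { intros u v Hu; unfold slope; simpl; field; lra. }
  assert (Hlt1 : slope (m, m) < slope top).
  { apply Hlt; auto; unfold top; intros E; injection E; lra. }
  (* Doubling keeps slopes: these two points have the slopes of [top] and [(m, m)], which differ
     because [m < M] and are not among the new slopes. *)
  exists ((m + m, M + M) :: (m + m, m + m) :: L'); split; [|split].
  + simpl; rewrite !Edbl by easy; fold top; constructor; [|constructor]; auto.
    * intros [H|H]; [lra|]; apply in_map_iff in H as (z & Ez & Hz).
      now apply (Hgap z Hz top).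
    * intros H; apply in_map_iff in H as (z & Ez & Hz).
      now apply (Hgap z Hz (m, m)).
  + simpl; rewrite Hlen'; f_equal.
    rewrite <- length_prod; fold P; rewrite EP, !length_app; simpl; lia.
  + intros p [<-|[<-|Hp]].
    * exists m, m, M, M; auto.
    * exists m, m, m, m; auto 6.
    * destruct (Hfrom p Hp) as (p0 & Hp0 & q & Hq & ->).
      destruct (HP p0 (proj1 (Hrem p0 Hp0))), (HP q (HLP q (proj1 Hq))).
      exists (fst p0), (fst q), (snd p0), (snd q); repeat split; auto.
      unfold comb; f_equal; ring.
Qed.

(** The [n + 1] slopes bound [n] gaps, each containing the slopes of |X|^2 combinations. Points from
    different gaps differ by slope, and those from one gap by linear independence. *)
Lemma consecutive_slopes_combs (L : list (R * R)) (X : list R) (n : nat) :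
  NoDup (map slope L) -> length L = S n -> (forall p, In p L -> 0 < fst p) ->
  NoDup X -> (forall x, In x X -> 0 < x) ->
  exists G : list (R * R), NoDup G /\ length G = (n * (length X * length X))%nat /\
    (forall z, In z G -> exists p q x y,
       In p L /\ In q L /\ In x X /\ In y X /\ z = comb x p y q).
Proof.
intros HL Hlen Hpos HX HX0.
destruct (exists_max slope L) as (top & Htop & Hmax); [now intros -> |].
destruct (in_split top L Htop) as (L1 & L2 & EL).
assert (HLnd : NoDup L) by now apply NoDup_map_inv in HL.
assert (Hrem : forall p, In p (L1 ++ L2) -> In p L /\ slope p < slope top).
{ intros p Hp.
  assert (HpL : In p L).
  { rewrite EL; apply in_app_iff in Hp as []; apply in_app_iff; simpl; auto. }
  split; auto; destruct (Hmax p HpL) as [|E]; auto.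
  apply (NoDup_map_inj_in slope L) in E; auto; subst p.
  rewrite EL in HLnd; now apply NoDup_remove_2 in HLnd. }
destruct (choose_NoDup_map (fun z : R * R => z)
  (fun pxy z => exists q, is_next slope L (slope (fst pxy)) q /\
     z = comb (fst (snd pxy)) (fst pxy) (snd (snd pxy)) q)
  (list_prod (L1 ++ L2) (list_prod X X))) as (G & HG & HGlen & Hfrom).
- apply NoDup_list_prod; [|now apply NoDup_list_prod].
  rewrite EL in HLnd; now apply NoDup_remove_1 in HLnd.
- intros [p [x y]] H; apply in_prod_iff in H as [Hp _].
  destruct (Hrem p Hp) as [HpL Hlt].
  destruct (exists_next slope L (slope p) top Htop Hlt) as [q Hq].
  now exists (comb x p y q), q.
- intros [p [x y]] [p' [x' y']] z z' H H' (q & Hq & Ez) (q' & Hq' & Ez') E.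
  simpl in *.
  apply in_prod_iff in H as [Hp Hxy]; apply in_prod_iff in Hxy as [Hx Hy].
  apply in_prod_iff in H' as [Hp' Hxy']; apply in_prod_iff in Hxy' as [Hx' Hy'].
  destruct (Hrem p Hp) as [HpL _], (Hrem p' Hp') as [HpL' _].
  assert (B := slope_comb_between x y p q (HX0 x Hx) (HX0 y Hy) (Hpos p HpL)
    (Hpos q (proj1 Hq)) (proj1 (proj2 Hq))).
  assert (B' := slope_comb_between x' y' p' q' (HX0 x' Hx') (HX0 y' Hy') (Hpos p' HpL')
    (Hpos q' (proj1 Hq')) (proj1 (proj2 Hq'))).
  rewrite <- Ez in B; rewrite <- Ez', <- E in B'.
  assert (Es : slope p = slope p') by (eapply is_next_gap; eauto).
  assert (p = p') by (eapply NoDup_map_inj_in; eauto); subst p'.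
  assert (q = q') by (eapply is_next_unique; eauto); subst q'.
  destruct (comb_inj x y x' y' p q) as [-> ->]; auto; [| |congruence].
  + apply Hpos, Hq.
  + lra.
- exists G; split; [now rewrite map_id in HG | split].
  + rewrite HGlen, !length_prod; f_equal.
    rewrite EL in Hlen; rewrite length_app in *; simpl in Hlen; lia.
  + intros z Hz; destruct (Hfrom z Hz) as ([p [x y]] & H & q & Hq & ->).
    apply in_prod_iff in H as [Hp Hxy]; apply in_prod_iff in Hxy as [Hx Hy].
    exists p, q, x, y; repeat split; auto; [apply Hrem, Hp | apply Hq].
Qed.

(** * Iterated sum sets and product sets *)

Lemma in_sum_set_add (P : R -> Prop) (m n : nat) (x y : R) :
  in_sum_set P m x -> in_sum_set P n y -> in_sum_set P (m + n) (x + y).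
Proof.
revert x; induction m as [|m IH]; simpl; intros x Hx Hy.
- subst; now rewrite Rplus_0_l.
- destruct Hx as (a & z & Ha & Hz & ->).
  exists a, (z + y); split; [easy | split; [auto | ring]].
Qed.

Lemma in_sum_set_mul (A : list R) (k n : nat) (a x : R) :
  In a A -> in_sum_set (in_prod_set A k) n x ->
  in_sum_set (in_prod_set A (S k)) n (a * x).
Proof.
intros Ha; revert x; induction n as [|n IH]; simpl; intros x Hx.
- subst; ring.
- destruct Hx as (b & z & Hb & Hz & ->).
  exists (a * b), (a * z); split; [now exists a, b | split; [auto | ring]].
Qed.

Lemma in_prod_set_pos (A : list R) (k : nat) (x : R) :
  (forall a, In a A -> 0 < a) -> in_prod_set A k x -> 0 < x.
Proof.
intros Hpos; revert x; induction k as [|k IH]; simpl; intros x Hx; [lra|].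
destruct Hx as (a & y & Ha & Hy & ->); apply Rmult_lt_0_compat; auto.
Qed.

Lemma in_sum_set_pos (P : R -> Prop) (n : nat) (x : R) :
  (forall a, P a -> 0 < a) -> in_sum_set P (S n) x -> 0 < x.
Proof.
intros Hpos; revert x; induction n as [|n IH]; intros x (a & y & Ha & Hy & ->).
- simpl in Hy; specialize (Hpos a Ha); lra.
- specialize (Hpos a Ha); specialize (IH y Hy); lra.
Qed.

(** * Growth by a factor |A| at each stage *)

(** The |A|^2 |X|^2 points built between consecutive slopes all lie in [U] x [U], where [U] lists
    all the values [(a + b) * x + (c + d) * y]. *)
Lemma sum_product_step (A X : list R) :
  NoDup A -> A <> [] -> (forall a, In a A -> 0 < a) ->
  NoDup X -> (forall x, In x X -> 0 < x) ->
  exists T : list R, NoDup T /\ length T = (length A * length X)%nat /\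
    (forall t, In t T -> exists a b c d x y,
       In a A /\ In b A /\ In c A /\ In d A /\ In x X /\ In y X /\
       t = (a + b) * x + (c + d) * y).
Proof.
intros HA Hne HA0 HX HX0.
set (AA := map (fun ab => fst ab + snd ab) (list_prod A A)).
set (AX := map (fun sx => fst sx * snd sx) (list_prod AA X)).
set (U := nodup Req_dec_T (map (fun uv => fst uv + snd uv) (list_prod AX AX))).
assert (HU : forall t, In t U <-> exists a b c d x y,
  In a A /\ In b A /\ In c A /\ In d A /\ In x X /\ In y X /\
  t = (a + b) * x + (c + d) * y).
{ intros t; unfold U, AX, AA; rewrite nodup_In; split.
  - intros H; apply in_map_iff in H as ([u v] & <- & H).
    apply in_prod_iff in H as [Hu Hv].
    apply in_map_iff in Hu as ([s x] & <- & Hu); apply in_prod_iff in Hu as [Hs Hx].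
    apply in_map_iff in Hv as ([s' y] & <- & Hv); apply in_prod_iff in Hv as [Hs' Hy].
    apply in_map_iff in Hs as ([a b] & <- & Hs); apply in_prod_iff in Hs as [Ha Hb].
    apply in_map_iff in Hs' as ([c d] & <- & Hs'); apply in_prod_iff in Hs' as [Hc Hd].
    exists a, b, c, d, x, y; auto 10.
  - intros (a & b & c & d & x & y & Ha & Hb & Hc & Hd & Hx & Hy & ->).
    apply in_map_iff; exists ((a + b) * x, (c + d) * y); split; [easy|].
    apply in_prod; apply in_map_iff.
    + exists (a + b, x); split; [easy|]; apply in_prod; auto.
      apply in_map_iff; exists (a, b); split; [easy | now apply in_prod].
    + exists (c + d, y); split; [easy|]; apply in_prod; auto.
      apply in_map_iff; exists (c, d); split; [easy | now apply in_prod]. }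
assert (HUnd : NoDup U) by apply NoDup_nodup.
assert (Hbig : (length A * length X <= length U)%nat).
{ destruct (Nat.le_gt_cases 2 (length A)) as [H2|H2].
  - destruct (sumset_many_slopes A HA H2 HA0) as (L & HL & HLlen & HLA).
    destruct (consecutive_slopes_combs L X _ HL HLlen) as (G & HG & HGlen & HGL); auto.
    { intros p Hp; destruct (HLA p Hp) as (a & b & c & d & Ha & Hb & _ & _ & ->).
      specialize (HA0 a Ha) as Ha0; specialize (HA0 b Hb) as Hb0; simpl; lra. }
    (* Abscissas and ordinates of [p] and [q] are sums of two elements of [A], so each coordinate of
       [comb x p y q] has the form required by [U]. *)
    assert (Hincl : incl G (list_prod U U)).
    { intros z Hz; destruct (HGL z Hz) as (p & q & x & y & Hp & Hq & Hx & Hy & ->).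
      destruct (HLA p Hp) as (a & b & c & d & Ha & Hb & Hc & Hd & ->).
      destruct (HLA q Hq) as (a' & b' & c' & d' & Ha' & Hb' & Hc' & Hd' & ->).
      apply in_prod; apply HU.
      - exists a, b, a', b', x, y; repeat split; auto; simpl; ring.
      - exists c, d, c', d', x, y; repeat split; auto; simpl; ring. }
    apply NoDup_incl_length in Hincl; auto.
    rewrite HGlen, length_prod in Hincl.
    destruct (Nat.le_gt_cases (length A * length X) (length U)); [easy | nia].
  (* For a singleton there is only one slope and no gap; instead, multiplication by [4 * a] embeds
     [X] into [U]. *)
  - destruct A as [|a [|b A]]; [easy| | simpl in H2; lia].
    simpl; rewrite Nat.add_0_r.
    assert (Ha0 := HA0 a (or_introl eq_refl)).
    rewrite <- (length_map (fun x => (a + a) * x + (a + a) * x) X).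
    apply NoDup_incl_length.
    + apply NoDup_map_NoDup_ForallPairs; auto.
      intros x y _ _ E; apply Rmult_eq_reg_l with (a + a + (a + a)); lra.
    + intros t Ht; apply in_map_iff in Ht as (x & <- & Hx); apply HU.
      exists a, a, a, a, x, x; simpl; auto 10. }
(* Truncation gives the exact length, so that the induction produces exactly a power of |A|. *)
exists (firstn (length A * length X) U); split; [|split].
- rewrite <- (firstn_skipn (length A * length X) U) in HUnd.
  now apply NoDup_app_remove_r in HUnd.
- now apply firstn_length_le.
- intros t Ht; apply HU; rewrite <- (firstn_skipn (length A * length X) U).
  apply in_app_iff; auto.
Qed.

(* |4^(k-1) A^(k)| >= |A|^k, where A is a finite nonempty set of positive
   reals (duplicate-free nonempty list); the cardinality bound on the
   (finite) sum-product set is expressed as: it contains |A|^k distinct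
   elements. *)
Theorem theorem3 (A : list R) (k : nat) :
  NoDup A -> A <> [] -> (forall a, In a A -> 0 < a) -> (1 <= k)%nat ->
  exists S : list R,
    NoDup S /\ length S = (length A ^ k)%nat /\
    (forall s, In s S -> in_sum_set (in_prod_set A k) (4 ^ (k - 1)) s).
Proof.
intros HA Hne HA0 Hk.
destruct k as [|k]; [lia|]; clear Hk.
replace (S k - 1)%nat with k by lia.
induction k as [|k (X & HX & HXlen & HXin)].
- exists A; split; [easy | split; [simpl; lia|]].
  (* One summand with one factor: [s = s * 1 + 0], ending in the empty product and the empty sum. *)
  intros s Hs; exists s, 0; split; [|split; [easy | ring]].
  exists s, 1; split; [easy | split; [easy | ring]].
- destruct (sum_product_step A X) as (T & HT & HTlen & HTin); auto.
  { intros x Hx; specialize (HXin x Hx).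
    assert (Hpow := Nat.pow_nonzero 4 k ltac:(lia)).
    (* Positivity needs at least one summand, since the empty sum is 0. *)
    destruct (4 ^ k)%nat as [|n]; [easy|].
    apply (in_sum_set_pos (in_prod_set A (S k)) n); auto.
    intros a; now apply in_prod_set_pos. }
  exists T; split; [easy | split; [now rewrite HTlen, HXlen|]].
  intros t Ht.
  destruct (HTin t Ht) as (a & b & c & d & x & y & Ha & Hb & Hc & Hd & Hx & Hy & ->).
  (* Expanding gives [a * x + b * x + c * y + d * y]; each term is a sum of [4 ^ k] products with
     one factor more than before. *)
  replace (4 ^ S k)%nat with ((4 ^ k + 4 ^ k) + (4 ^ k + 4 ^ k))%nat by (simpl; lia).
  rewrite !Rmult_plus_distr_r.
  repeat apply in_sum_set_add; apply in_sum_set_mul; auto.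
Qed.
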